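(* Let $H$ be a cocommutative bialgebra over a commutative ring $R$. Then the set of liftable elements of $H$ is a Lie algebra over $R$, i.e. it is an $R$-submodule of $H$ closed under the commutator bracket $[a,b]=ab-ba$.
   Context: An element $a_1\in H$ is liftable (to a group-like element) if there are elements $a_n\in H$ ($n\ge0$), with $a_0=1$ and with the given $a_1$, such that $\sum_{n\ge0}a_nx^n\in H[[x]]$ is group-like, i.e. $\Delta(a_n)=\sum_{0\le m\le n}a_m\otimes a_{n-m}$ for all $n\ge0$. (A liftable element is in particular primitive: $\Delta(a_1)=a_1\otimes1+1\otimes a_1$.) *)

(* Defs.v *)
From HB Require Import structures.
From mathcomp Require Import all_boot all_algebra.
From mathcomp Require Import boolp.

Set Implicit Arguments.
Unset Strict Implicit.
Unset Printing Implicit Defensive.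

Import GRing.Theory.
Local Open Scope ring_scope.
Local Open Scope quotient_scope.

Reserved Notation "u ⊗ v" (at level 40, left associativity).

Section Bilinear.
Variables (R : comPzRingType) (U V W : lmodType R).

Definition bilin (f : U -> V -> W) :=
  (forall v, linear (f^~ v)) /\ (forall u, linear (f u)).

Variable f : U -> V -> W.
Hypothesis bf : bilin f.

Lemma bilinDl u u' v : f (u + u') v = f u v + f u' v.
Proof. by have := bf.1 v 1 u u'; rewrite !scale1r. Qed.
Lemma bilinDr u v v' : f u (v + v') = f u v + f u v'.
Proof. by have := bf.2 u 1 v v'; rewrite !scale1r. Qed.
Lemma bilin0l v : f 0 v = 0.
Proof. by apply: (addrI (f 0 v)); rewrite -bilinDl !addr0. Qed.
Lemma bilin0r u : f u 0 = 0.
Proof. by apply: (addrI (f u 0)); rewrite -bilinDr !addr0. Qed.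
Lemma bilinZl a u v : f (a *: u) v = a *: f u v.
Proof. by have := bf.1 v a u 0; rewrite bilin0l !addr0. Qed.
Lemma bilinZr a u v : f u (a *: v) = a *: f u v.
Proof. by have := bf.2 u a v 0; rewrite bilin0r !addr0. Qed.

End Bilinear.

(* The tensor product over R.  The list [:: (u1, v1); ...; (un, vn)] stands
   for u1 ⊗ v1 + ... + un ⊗ vn; tensor_rel is the congruence imposing
   commutativity of + and the bilinearity relations (made boolean classically
   in order to form the quotient). *)
Section Tensor.
Variables (R : comPzRingType) (U V : lmodType R).

Inductive tensor_rel : seq (U * V) -> seq (U * V) -> Prop :=
| tensor_refl s : tensor_rel s s
| tensor_sym s t : tensor_rel s t -> tensor_rel t s
| tensor_trans s t r : tensor_rel s t -> tensor_rel t r -> tensor_rel s r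
| tensor_cat s s' t t' :
    tensor_rel s s' -> tensor_rel t t' -> tensor_rel (s ++ t) (s' ++ t')
| tensor_catC s t : tensor_rel (s ++ t) (t ++ s)
| tensor_zero v : tensor_rel [:: (0, v)] [::]
| tensor_addl u u' v : tensor_rel [:: (u + u', v)] [:: (u, v); (u', v)]
| tensor_addr u v v' : tensor_rel [:: (u, v + v')] [:: (u, v); (u, v')]
| tensor_scale a u v : tensor_rel [:: (a *: u, v)] [:: (u, a *: v)].

Definition tensor_relb s t := `[< tensor_rel s t >].

Lemma tensor_relb_refl : reflexive tensor_relb.
Proof. by move=> s; apply/asboolP; exact: tensor_refl. Qed.
Lemma tensor_relb_sym : symmetric tensor_relb.
Proof. by move=> s t; apply/asboolP/asboolP; exact: tensor_sym. Qed.
Lemma tensor_relb_trans : transitive tensor_relb.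
Proof.
by move=> s t r /asboolP h1 /asboolP h2; apply/asboolP; exact: tensor_trans h1 h2.
Qed.

Canonical tensor_equiv :=
  EquivRel tensor_relb tensor_relb_refl tensor_relb_sym tensor_relb_trans.

Definition tensor := {eq_quot tensor_equiv}.
HB.instance Definition _ := Choice.on tensor.
HB.instance Definition _ := Quotient.on tensor.

Definition tens (u : U) (v : V) : tensor := \pi_tensor [:: (u, v)].

Lemma tensor_eqP (s t : seq (U * V)) :
  reflect (tensor_rel s t) (\pi_tensor s == \pi_tensor t).
Proof. by rewrite eqmodE; exact: asboolP. Qed.

Lemma tensor_pi (s t : seq (U * V)) :
  tensor_rel s t -> \pi_tensor s = \pi_tensor t.
Proof. by move/tensor_eqP/eqP. Qed.

Lemma tensor_repr (s : seq (U * V)) : tensor_rel (repr (\pi_tensor s)) s.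
Proof. by apply/tensor_eqP; rewrite reprK. Qed.

Lemma tensorW (P : tensor -> Prop) :
  (forall s, P (\pi_tensor s)) -> forall x, P x.
Proof. by move=> h x; rewrite -[x]reprK. Qed.

Definition tensor0 : tensor := \pi_tensor [::].
Definition tensorD (x y : tensor) : tensor := \pi_tensor (repr x ++ repr y).
Definition tensorZ (a : R) (x : tensor) : tensor :=
  \pi_tensor [seq (a *: p.1, p.2) | p <- repr x].

Lemma tensorD_pi s t : tensorD (\pi_tensor s) (\pi_tensor t) = \pi_tensor (s ++ t).
Proof. by apply: tensor_pi; apply: tensor_cat; exact: tensor_repr. Qed.

Lemma tensor_rel_scale a s t : tensor_rel s t ->
  tensor_rel [seq (a *: p.1, p.2) | p <- s] [seq (a *: p.1, p.2) | p <- t].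
Proof.
elim=> [x|x y _ h|x y z _ h1 _ h2|x x' y y' _ h1 _ h2|x y|v|u u' v|u v v'|b u v].
- exact: tensor_refl.
- exact: tensor_sym.
- exact: tensor_trans h1 h2.
- by rewrite !map_cat; exact: tensor_cat.
- by rewrite !map_cat; exact: tensor_catC.
- by rewrite /= scaler0; exact: tensor_zero.
- by rewrite /= scalerDr; exact: tensor_addl.
- exact: tensor_addr.
- by rewrite /= scalerA mulrC -scalerA; exact: tensor_scale.
Qed.

Lemma tensorZ_pi a s :
  tensorZ a (\pi_tensor s) = \pi_tensor [seq (a *: p.1, p.2) | p <- s].
Proof. by apply: tensor_pi; apply: tensor_rel_scale; exact: tensor_repr. Qed.

Lemma tensorDA : associative tensorD.
Proof.
move=> x y z; elim/tensorW: x => x; elim/tensorW: y => y; elim/tensorW: z => z.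
by rewrite !tensorD_pi catA.
Qed.
Lemma tensorDC : commutative tensorD.
Proof.
move=> x y; elim/tensorW: x => x; elim/tensorW: y => y; rewrite !tensorD_pi.
by apply: tensor_pi; exact: tensor_catC.
Qed.
Lemma tensor0D : left_id tensor0 tensorD.
Proof. by move=> x; elim/tensorW: x => x; rewrite tensorD_pi. Qed.

Lemma tensor_rel_addl a b s : tensor_rel [seq ((a + b) *: p.1, p.2) | p <- s]
  ([seq (a *: p.1, p.2) | p <- s] ++ [seq (b *: p.1, p.2) | p <- s]).
Proof.
elim: s => [|[u v] s IH] /=; first exact: tensor_refl.
apply: (tensor_trans (t := [:: (a *: u, v); (b *: u, v)] ++
  ([seq (a *: p.1, p.2) | p <- s] ++ [seq (b *: p.1, p.2) | p <- s]))).
  by rewrite -cat1s scalerDl; apply: tensor_cat => //; exact: tensor_addl.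
apply: (tensor_cat (s := [:: (a *: u, v)]) (s' := [:: (a *: u, v)])).
  exact: tensor_refl.
rewrite -[X in tensor_rel _ (_ ++ X)]cat1s catA.
apply: (tensor_cat (s := (b *: u, v) :: [seq (a *: p.1, p.2) | p <- s])).
  exact: (tensor_catC [:: (b *: u, v)]).
exact: tensor_refl.
Qed.

Lemma tensor_rel_scale0 s : tensor_rel [seq ((0 : R) *: p.1, p.2) | p <- s] [::].
Proof.
elim: s => [|[u v] s IH] /=; first exact: tensor_refl.
rewrite scale0r -cat1s -[X in tensor_rel _ X]/([::] ++ [::]).
by apply: tensor_cat => //; exact: tensor_zero.
Qed.

Lemma tensorND : left_inverse tensor0 (tensorZ (-1)) tensorD.
Proof.
move=> x; elim/tensorW: x => x; rewrite tensorZ_pi tensorD_pi; apply: tensor_pi.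
have := tensor_rel_addl (-1) 1 x; rewrite addNr => h.
have := tensor_trans (tensor_sym h) (tensor_rel_scale0 x).
rewrite [X in _ ++ X](_ : _ = x) // -[RHS]map_id.
by apply: eq_map => -[u v] /=; rewrite scale1r.
Qed.

HB.instance Definition _ :=
  GRing.isZmodule.Build tensor tensorDA tensorDC tensor0D tensorND.

Lemma tensorZA a b x : tensorZ a (tensorZ b x) = tensorZ (a * b) x.
Proof.
elim/tensorW: x => x; rewrite !tensorZ_pi -map_comp; congr (\pi_tensor _).
by apply: eq_map => p /=; rewrite scalerA.
Qed.
Lemma tensor1Z : left_id 1 tensorZ.
Proof.
move=> x; elim/tensorW: x => x; rewrite tensorZ_pi; congr (\pi_tensor _).
by rewrite -[RHS]map_id; apply: eq_map => -[u v] /=; rewrite scale1r.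
Qed.
Lemma tensorZDr : right_distributive tensorZ +%R.
Proof.
move=> a; move=> x y; elim/tensorW: x => x; elim/tensorW: y => y.
by rewrite /GRing.add /= tensorD_pi !tensorZ_pi tensorD_pi map_cat.
Qed.
Lemma tensorZDl x : {morph tensorZ^~ x : a b / a + b}.
Proof.
move=> a b; elim/tensorW: x => x; rewrite !tensorZ_pi.
by rewrite [RHS]tensorD_pi; apply: tensor_pi; exact: tensor_rel_addl.
Qed.

HB.instance Definition _ := GRing.Zmodule_isLmodule.Build R tensor
  tensorZA tensor1Z tensorZDr tensorZDl.

End Tensor.

Notation "u ⊗ v" := (tens u v) : ring_scope.

(* The linear map u ⊗ v |-> f u v induced by f.  It is defined through chosen
   representatives, hence meaningful only for bilinear f; see tlift_tens and
   tlift_unique for the universal property. *)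
Definition tlift (R : comPzRingType) (U V W : lmodType R) (f : U -> V -> W)
    (x : tensor U V) : W :=
  \sum_(p <- repr x) f p.1 p.2.

Section TensorTheory.
Variables (R : comPzRingType) (U V : lmodType R).

Lemma tens_bilin : bilin (@tens R U V).
Proof.
have addE (p q : U * V) : \pi_(tensor U V) [:: p] + \pi_(tensor U V) [:: q] =
    \pi_(tensor U V) [:: p; q] by exact: tensorD_pi.
have scaleE a (p : U * V) : a *: \pi_(tensor U V) [:: p] =
    \pi_(tensor U V) [:: (a *: p.1, p.2)] by exact: tensorZ_pi.
split=> [v a u u'|u a v v']; rewrite /tens scaleE addE; apply: tensor_pi.
  exact: tensor_addl.
apply: tensor_trans (tensor_addr _ _ _) _.
apply: (tensor_cat (s := [:: _]) (s' := [:: _])); last exact: tensor_refl.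
exact/tensor_sym/tensor_scale.
Qed.

Lemma tensor_sumE (s : seq (U * V)) :
  \pi_(tensor U V) s = \sum_(p <- s) p.1 ⊗ p.2.
Proof.
elim: s => [|[u v] s IH]; first by rewrite big_nil.
by rewrite big_cons -IH [RHS]tensorD_pi.
Qed.

Lemma tensor_ind (P : tensor U V -> Prop) :
  P 0 -> (forall u v, P (u ⊗ v)) -> (forall x y, P x -> P y -> P (x + y)) ->
  forall x, P x.
Proof.
move=> P0 Pt PD; move=> x; elim/tensorW: x => s; rewrite tensor_sumE.
by elim/big_ind: _ => //.
Qed.

Variable W : lmodType R.

Section Lift.
Variables (f : U -> V -> W) (bf : bilin f).

Lemma tensor_rel_sum (s t : seq (U * V)) : tensor_rel s t ->
  \sum_(p <- s) f p.1 p.2 = \sum_(p <- t) f p.1 p.2.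
Proof.
elim=>
  [x|x y _ h|x y z _ h1 _ h2|x x' y y' _ h1 _ h2|x y|v|u u' v|u v v'|b u v].
- by [].
- exact: esym h.
- exact: etrans h1 h2.
- by rewrite !big_cat /= h1 h2.
- by rewrite !big_cat /= addrC.
- by rewrite big_seq1 big_nil /= (bilin0l bf).
- by rewrite !big_cons !big_nil !addr0 /= (bilinDl bf).
- by rewrite !big_cons !big_nil !addr0 /= (bilinDr bf).
- by rewrite !big_seq1 /= (bilinZl bf) (bilinZr bf).
Qed.

Lemma tlift_pi (s : seq (U * V)) :
  tlift f (\pi_(tensor U V) s) = \sum_(p <- s) f p.1 p.2.
Proof. exact/tensor_rel_sum/tensor_repr. Qed.

Lemma tlift_tens u v : tlift f (u ⊗ v) = f u v.
Proof. by rewrite tlift_pi big_seq1. Qed.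

Lemma tlift_linear : linear (tlift f).
Proof.
move=> a; move=> x y; elim/tensorW: x => x; elim/tensorW: y => y.
have -> : a *: \pi_(tensor U V) x + \pi_(tensor U V) y =
    \pi_(tensor U V) ([seq (a *: p.1, p.2) | p <- x] ++ y).
  by rewrite -tensorD_pi -tensorZ_pi.
rewrite !tlift_pi big_cat /=.
rewrite big_map scaler_sumr; congr (_ + _); apply: eq_bigr => p _ /=.
by rewrite (bilinZl bf).
Qed.

Lemma tliftD x y : tlift f (x + y) = tlift f x + tlift f y.
Proof. by have := tlift_linear 1 x y; rewrite !scale1r. Qed.
Lemma tlift0 : tlift f 0 = 0.
Proof. by rewrite [X in tlift _ X](_ : 0 = \pi_(tensor U V) [::]) // tlift_pi big_nil. Qed.
Lemma tliftZ a x : tlift f (a *: x) = a *: tlift f x.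
Proof. by have := tlift_linear a x 0; rewrite tlift0 !addr0. Qed.

End Lift.

Lemma tlift_unique (f : U -> V -> W) (g : {linear tensor U V -> W}) :
  (forall u v, g (u ⊗ v) = f u v) -> g =1 tlift f.
Proof.
move=> gf x; have bf : bilin f.
  split=> [v a u u'|u a v v']; rewrite -!gf.
    by rewrite (bilinDl tens_bilin) (bilinZl tens_bilin) linearP.
  by rewrite (bilinDr tens_bilin) (bilinZr tens_bilin) linearP.
elim/tensor_ind: x => [|u v|x y hx hy]; first by rewrite linear0 tlift0.
  by rewrite gf tlift_tens.
by rewrite linearD tliftD // hx hy.
Qed.

Lemma tlift_comb a (f g h : U -> V -> W) x :
  (forall u v, h u v = a *: f u v + g u v) ->
  tlift h x = a *: tlift f x + tlift g x.
Proof.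
move=> e; rewrite /tlift scaler_sumr -big_split /=.
by apply: eq_bigr => p _; rewrite e.
Qed.

End TensorTheory.

Section TensorMaps.
Variable R : comPzRingType.

Definition tmap (U V U' V' : lmodType R) (f : U -> U') (g : V -> V') :
    tensor U V -> tensor U' V' :=
  tlift (fun u v => f u ⊗ g v).

Definition tswap (U V : lmodType R) : tensor U V -> tensor V U :=
  tlift (fun u v => v ⊗ u).

Definition tassoc (U V W : lmodType R) :
    tensor (tensor U V) W -> tensor U (tensor V W) :=
  tlift (fun x w => tlift (fun u v => u ⊗ (v ⊗ w)) x).

Lemma tmap_bilin (U V U' V' : lmodType R)
    (f : {linear U -> U'}) (g : {linear V -> V'}) :
  bilin (fun u v => f u ⊗ g v).
Proof.
split=> [v a u u'|u a v v'] /=; rewrite linearP.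
  by rewrite (bilinDl (tens_bilin _ _)) (bilinZl (tens_bilin _ _)).
by rewrite (bilinDr (tens_bilin _ _)) (bilinZr (tens_bilin _ _)).
Qed.

Lemma tmap_tens (U V U' V' : lmodType R)
    (f : {linear U -> U'}) (g : {linear V -> V'}) u v :
  tmap f g (u ⊗ v) = f u ⊗ g v.
Proof. exact: (tlift_tens (tmap_bilin f g)). Qed.

Lemma tswap_bilin (U V : lmodType R) : bilin (fun (u : U) (v : V) => v ⊗ u).
Proof. by have [bl br] := tens_bilin V U; split=> [v|u]; [exact: br|exact: bl]. Qed.

Lemma tswap_tens (U V : lmodType R) (u : U) (v : V) : tswap (u ⊗ v) = v ⊗ u.
Proof. exact: (tlift_tens (@tswap_bilin U V)). Qed.

Lemma tassoc_bilin0 (U V W : lmodType R) (w : W) :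
  bilin (fun (u : U) (v : V) => u ⊗ (v ⊗ w)).
Proof.
have b1 := tens_bilin U (tensor V W); have b2 := tens_bilin V W.
split=> [v|u a v v']; first exact: b1.1.
by rewrite (bilinDl b2) (bilinZl b2) (bilinDr b1) (bilinZr b1).
Qed.

Lemma tassoc_bilin (U V W : lmodType R) :
  bilin (fun (x : tensor U V) (w : W) => tlift (fun u v => u ⊗ (v ⊗ w)) x).
Proof.
have b1 := tens_bilin U (tensor V W); have b2 := tens_bilin V W.
split=> [w|x a w w']; first exact: tlift_linear (tassoc_bilin0 _ _ _).
apply: tlift_comb => u v.
by rewrite (bilinDr b2) (bilinZr b2) (bilinDr b1) (bilinZr b1).
Qed.

Lemma tassoc_tens (U V W : lmodType R) (u : U) (v : V) (w : W) :
  tassoc (u ⊗ v ⊗ w) = u ⊗ (v ⊗ w).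
Proof.
rewrite /tassoc (tlift_tens (tassoc_bilin U V W)).
exact: (tlift_tens (tassoc_bilin0 U V w)).
Qed.

End TensorMaps.

(* The product of A ⊗ B: (a ⊗ b)(c ⊗ d) = ac ⊗ bd.  Only a pzRingType, not an
   algType, because A ⊗ B may be zero. *)
Section TensorAlgebra.
Variables (R : comPzRingType) (A B : algType R).

Definition tmul (x y : tensor A B) : tensor A B :=
  tlift (fun a b => tlift (fun c d => (a * c) ⊗ (b * d)) y) x.

Let bt := tens_bilin A B.

Lemma tmul_bilin0 (a : A) (b : B) : bilin (fun c d => (a * c) ⊗ (b * d)).
Proof.
split=> [d k c c'|c k d d'] /=; rewrite mulrDr -scalerAr.
  by rewrite (bilinDl bt) (bilinZl bt).
by rewrite (bilinDr bt) (bilinZr bt).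
Qed.

Lemma tmul_bilin1 (y : tensor A B) :
  bilin (fun a b => tlift (fun c d => (a * c) ⊗ (b * d)) y).
Proof.
split=> [b k a a'|a k b b'] /=; apply: tlift_comb => c d;
  rewrite mulrDl -scalerAl.
  by rewrite (bilinDl bt) (bilinZl bt).
by rewrite (bilinDr bt) (bilinZr bt).
Qed.

Lemma tmul_bilin : bilin tmul.
Proof.
split=> [y|x k y y']; first exact: tlift_linear (tmul_bilin1 y).
by apply: tlift_comb => a b; rewrite (tlift_linear (tmul_bilin0 a b)).
Qed.

Lemma tmul_tens a b c d : tmul (a ⊗ b) (c ⊗ d) = (a * c) ⊗ (b * d).
Proof.
by rewrite /tmul (tlift_tens (tmul_bilin1 _)) (tlift_tens (tmul_bilin0 a b)).
Qed.

Lemma tmulDl : left_distributive tmul +%R.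
Proof. by move=> x y z; rewrite (bilinDl tmul_bilin). Qed.
Lemma tmulDr : right_distributive tmul +%R.
Proof. by move=> x y z; rewrite (bilinDr tmul_bilin). Qed.

Lemma tmulA : associative tmul.
Proof.
move=> x y z; elim/tensor_ind: x => [|a b|x x' hx hx'].
- by rewrite !(bilin0l tmul_bilin).
- elim/tensor_ind: y => [|c d|y y' hy hy'].
  + by rewrite (bilin0l tmul_bilin) !(bilin0r tmul_bilin) (bilin0l tmul_bilin).
  + elim/tensor_ind: z => [|e f|z z' hz hz'].
    * by rewrite !(bilin0r tmul_bilin).
    * by rewrite !tmul_tens !mulrA.
    * by rewrite !tmulDr hz hz'.
  + by rewrite tmulDl !tmulDr tmulDl hy hy'.
- by rewrite !tmulDl hx hx'.
Qed.

Lemma tmul1l : left_id (1 ⊗ 1) tmul.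
Proof.
elim/tensor_ind=> [|a b|x y hx hy]; first by rewrite (bilin0r tmul_bilin).
  by rewrite tmul_tens !mul1r.
by rewrite tmulDr hx hy.
Qed.

Lemma tmul1r : right_id (1 ⊗ 1) tmul.
Proof.
elim/tensor_ind=> [|a b|x y hx hy]; first by rewrite (bilin0l tmul_bilin).
  by rewrite tmul_tens !mulr1.
by rewrite tmulDl hx hy.
Qed.

HB.instance Definition _ := GRing.Zmodule_isPzRing.Build (tensor A B)
  tmulA tmul1l tmul1r tmulDl tmulDr.

Lemma tensor_scaleAl (k : R) (x y : tensor A B) : k *: (x * y) = (k *: x) * y.
Proof. by rewrite [RHS](bilinZl tmul_bilin). Qed.
Lemma tensor_scaleAr (k : R) (x y : tensor A B) : k *: (x * y) = x * (k *: y).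
Proof. by rewrite [RHS](bilinZr tmul_bilin). Qed.

Lemma mul_tens (a c : A) (b d : B) : (a ⊗ b) * (c ⊗ d) = (a * c) ⊗ (b * d).
Proof. exact: tmul_tens. Qed.

Lemma tens11 : (1 : A) ⊗ (1 : B) = 1.
Proof. by []. Qed.

End TensorAlgebra.

HB.mixin Record Algebra_isBialgebra (R : comPzRingType) H
    of GRing.Algebra R H := {
  comul : H -> tensor H H;
  counit : H -> R;
  comul_linear : linear comul;
  comul_monoid : monoid_morphism comul;
  counit_scalar : scalar counit;
  counit_monoid : monoid_morphism counit;
  comulA : forall x : H, tassoc (tmap comul id (comul x)) = tmap id comul (comul x);
  counitl : forall x : H, tlift (fun a b : H => counit a *: b) (comul x) = x;
  counitr : forall x : H, tlift (fun a b : H => counit b *: a) (comul x) = x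
}.

#[short(type="bialgType")]
HB.structure Definition Bialgebra (R : comPzRingType) :=
  { H of GRing.Algebra R H & Algebra_isBialgebra R H }.

HB.instance Definition _ (R : comPzRingType) (H : bialgType R) :=
  GRing.isLinear.Build R H (tensor H H) *:%R (@comul R H) comul_linear.
HB.instance Definition _ (R : comPzRingType) (H : bialgType R) :=
  GRing.isMonoidMorphism.Build H (tensor H H) (@comul R H) comul_monoid.
HB.instance Definition _ (R : comPzRingType) (H : bialgType R) :=
  GRing.isLinear.Build R H R *%R (@counit R H) counit_scalar.
HB.instance Definition _ (R : comPzRingType) (H : bialgType R) :=
  GRing.isMonoidMorphism.Build H R (@counit R H) counit_monoid.

Definition cocommutative (R : comPzRingType) (H : bialgType R) :=
  forall x : H, tswap (comul x) = comul x.

Definition primitive (R : comPzRingType) (H : bialgType R) (x : H) :=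
  comul x = x ⊗ 1 + 1 ⊗ x.

(* \sum_n a n x^n is a group-like element of H[[x]] *)
Definition grouplike_series (R : comPzRingType) (H : bialgType R)
    (a : nat -> H) :=
  a 0 = 1 /\ forall n, comul (a n) = \sum_(m < n.+1) a m ⊗ a (n - m)%N.

Definition liftable (R : comPzRingType) (H : bialgType R) (x : H) :=
  exists2 a : nat -> H, grouplike_series a & a 1 = x.

Lemma liftable_primitive (R : comPzRingType) (H : bialgType R) (x : H) :
  liftable x -> primitive x.
Proof.
case=> a [a0 ga] <-; rewrite /primitive ga !big_ord_recr big_ord0 /= add0r.
by rewrite subn0 subnn a0 addrC.
Qed.

Definition lie (A : pzRingType) (x y : A) := x * y - y * x.

Definition lie_subalgebra (R : comPzRingType) (A : algType R)
    (S : A -> Prop) :=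
  [/\ S 0,
      forall x y, S x -> S y -> S (x + y),
      forall (r : R) x, S x -> S (r *: x)
    & forall x y, S x -> S y -> S (lie x y)].

(* Main.v *)
Require Import Defs.
From HB Require Import structures.
From mathcomp Require Import all_boot all_algebra.
From mathcomp Require Import boolp zify.

(** Let a(s) and b(t) be group-like series lifting a_1 and b_1, in separate
    variables.  Then G = b(t)^-1 a(s) b(t) in H[[t]][[s]] is group-like, with
    constant coefficient 1 in s.  It factors uniquely as G = U V, where U and V
    have constant coefficient 1 in s, the monomials s^m t^n in V satisfy n <= m, and
    those in U other than 1 satisfy n > m.  Both supports are closed under
    addition, so comparing the factorizations (Delta U)(Delta V) and
    (U ⊗ U)(V ⊗ V) of Delta G shows that V is group-like.  As the diagonal is an
    extreme ray of the support of V, the diagonal coefficients of V form a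
    group-like series by themselves; its first coefficient is the one of s t in
    G, namely [a_1, b_1].  For sums use a(x) b(x), for multiples a(r x). *)

Set Implicit Arguments.
Unset Strict Implicit.
Unset Printing Implicit Defensive.

Import GRing.Theory.
Local Open Scope ring_scope.

(** * Formal power series over a ring that need not be commutative *)

Definition series (A : Type) : Type := nat -> A.

Section SeriesRing.
Variable A : pzRingType.
Implicit Types f g h : series A.

HB.instance Definition _ := gen_eqMixin (series A).
HB.instance Definition _ := gen_choiceMixin (series A).

Definition series_add f g : series A := fun n => f n + g n.
Definition series_opp f : series A := fun n => - f n.
Definition series_const (c : A) : series A := fun n => if n is 0 then c else 0.
Definition series_mul f g : series A :=
  fun n => \sum_(i < n.+1) f i * g (n - i)%N.

Lemma series_addA : associative series_add.
Proof. by move=> f g h; apply/funext => n; exact: addrA. Qed.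
Lemma series_addC : commutative series_add.
Proof. by move=> f g; apply/funext => n; exact: addrC. Qed.
Lemma series_add0 : left_id (fun=> 0 : A) series_add.
Proof. by move=> f; apply/funext => n; exact: add0r. Qed.
Lemma series_addN : left_inverse (fun=> 0 : A) series_opp series_add.
Proof. by move=> f; apply/funext => n; exact: addNr. Qed.

HB.instance Definition _ := GRing.isZmodule.Build (series A)
  series_addA series_addC series_add0 series_addN.

Lemma series_mul_rev f g n :
  series_mul f g n = \sum_(i < n.+1) f (n - i)%N * g i.
Proof.
rewrite /series_mul (reindex_inj rev_ord_inj) /=.
by apply: eq_bigr => i _; rewrite subSS subKn // -ltnS.
Qed.

Lemma series_mulA : associative series_mul.
Proof.
move=> f g h; apply/funext => n; rewrite [RHS]series_mul_rev /series_mul.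
(* The term taking index j from f and k from h; both bracketings sum it over j + k <= n. *)
pose F j k := f j * (g (n - j - k)%N * h k).
transitivity (\sum_(j < n.+1) \sum_(k < n.+1 | (k <= n - j)%N) F j k).
  apply: eq_bigr => /= j _; rewrite -/(series_mul g h _) series_mul_rev.
  by rewrite big_distrr /= (big_ord_narrow_leq (leq_subr _ _)).
rewrite (exchange_big_dep predT) //=; apply: eq_bigr => k _.
transitivity (\sum_(j < n.+1 | (j <= n - k)%N) F j k).
  by apply: eq_bigl => j; rewrite /= -ltnS -(ltnS j) -!subSn ?leq_ord //; lia.
rewrite (big_ord_narrow_leq (leq_subr _ _)) /= big_distrl /=.
by apply: eq_bigr => j _; rewrite /F mulrA -!subnDA addnC.
Qed.

Lemma series_mul1l : left_id (series_const 1) series_mul.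
Proof.
move=> f; apply/funext => n; rewrite /series_mul big_ord_recl /= mul1r subn0.
by rewrite big1 ?addr0 // => i _; rewrite mul0r.
Qed.
Lemma series_mul1r : right_id (series_const 1) series_mul.
Proof.
move=> f; apply/funext => n; rewrite series_mul_rev big_ord_recl /= mulr1 subn0.
by rewrite big1 ?addr0 // => i _; rewrite mulr0.
Qed.
Lemma series_mulDl : left_distributive series_mul series_add.
Proof.
move=> f g h; apply/funext => n; rewrite /series_mul /series_add -big_split.
by apply: eq_bigr => i _; exact: mulrDl.
Qed.
Lemma series_mulDr : right_distributive series_mul series_add.
Proof.
move=> f g h; apply/funext => n; rewrite /series_mul /series_add -big_split.
by apply: eq_bigr => i _; exact: mulrDr.
Qed.

HB.instance Definition _ := GRing.Zmodule_isPzRing.Build (series A)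
  series_mulA series_mul1l series_mul1r series_mulDl series_mulDr.

Lemma coef_add f g n : (f + g) n = f n + g n. Proof. by []. Qed.
Lemma coef_opp f n : (- f) n = - f n. Proof. by []. Qed.
Lemma coef_mul f g n : (f * g) n = \sum_(i < n.+1) f i * g (n - i)%N.
Proof. by []. Qed.
Lemma coef_one n : (1 : series A) n = (n == 0)%:R. Proof. by case: n. Qed.

Lemma coef_sum (I : finType) (F : I -> series A) n :
  (\sum_i F i) n = \sum_i F i n.
Proof. by elim/big_rec2: _ => // i x y _ <-. Qed.

Lemma coef_mul0 f g : (f * g) 0 = f 0 * g 0.
Proof. by rewrite coef_mul big_ord_recl big_ord0 addr0 subn0. Qed.

Lemma coef_mul1 f g : (f * g) 1 = f 0 * g 1 + f 1 * g 0.
Proof. by rewrite coef_mul !big_ord_recl big_ord0 addr0. Qed.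

(** Splitting off both end terms isolates the new coefficients of f and g from products of earlier
    ones, so that the recursions for inverses and factorizations can solve for them. *)
Lemma coef_mulS f g n : (f * g) n.+1 =
  f 0 * g n.+1 + \sum_(i < n) f i.+1 * g (n - i)%N + f n.+1 * g 0.
Proof.
rewrite coef_mul big_ord_recl big_ord_recr /= subnn subn0 addrA.
by congr (_ + _ + _); apply: eq_bigr => i _ /=; rewrite /bump /= !add1n subSS.
Qed.

Lemma coef_mulS_unit f g n : f 0 = 1 -> g 0 = 1 ->
  (f * g) n.+1 = g n.+1 + f n.+1 + \sum_(i < n) f i.+1 * g (n - i)%N.
Proof. by move=> f0 g0; rewrite coef_mulS f0 g0 mul1r mulr1 addrAC. Qed.

Lemma series_const_is_zmod : zmod_morphism series_const.
Proof. by move=> x y; apply/funext => -[|n] //=; rewrite coef_add coef_opp subr0. Qed.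
Lemma series_const_is_monoid : monoid_morphism series_const.
Proof.
split=> // x y; apply/funext => -[|n]; first by rewrite coef_mul0.
by rewrite coef_mulS /= mulr0 mul0r add0r addr0 big1 // => i _; rewrite mul0r.
Qed.
HB.instance Definition _ := GRing.isZmodMorphism.Build A (series A)
  series_const series_const_is_zmod.
HB.instance Definition _ := GRing.isMonoidMorphism.Build A (series A)
  series_const series_const_is_monoid.

End SeriesRing.

(** * Coefficientwise ring morphisms between series *)

Section SeriesMap.
Variables (A B : pzRingType) (phi : {rmorphism A -> B}).

Definition series_map (f : series A) : series B := fun n => phi (f n).

Lemma coef_map f n : series_map f n = phi (f n). Proof. by []. Qed.

Lemma series_map_is_zmod : zmod_morphism series_map.
Proof. by move=> f g; apply/funext => n; exact: rmorphB. Qed.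
Lemma series_map_is_monoid : monoid_morphism series_map.
Proof.
split=> [|f g]; apply/funext => n.
  by rewrite /series_map !coef_one rmorph_nat.
rewrite /series_map coef_mul rmorph_sum coef_mul.
by apply: eq_bigr => i _; exact: rmorphM.
Qed.
HB.instance Definition _ := GRing.isZmodMorphism.Build (series A) (series B)
  series_map series_map_is_zmod.
HB.instance Definition _ := GRing.isMonoidMorphism.Build (series A) (series B)
  series_map series_map_is_monoid.

Lemma series_map_const c : series_map (series_const c) = series_const (phi c).
Proof. by apply/funext => -[|n] //; exact: rmorph0. Qed.

End SeriesMap.

(** * Sequences defined by recursion on all earlier terms, and inverses of series *)

Lemma causal_fixpoint (T : Type) (t : T) (Phi : (nat -> T) -> nat -> T) :
  (forall f g n, (forall k, (k < n)%N -> f k = g k) -> Phi f n = Phi g n) ->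
  exists f, forall n, f n = Phi f n.
Proof.
(* Entry n is final from iterate n + 1 on, whatever the start t, so the diagonal [a n.+1 n] is a
   fixed point. *)
move=> causal; pose a k := iter k Phi (fun=> t).
have stable n : forall k l, (n < k)%N -> (n < l)%N -> a k n = a l n.
  elim/ltn_ind: n => n IH [|k] // [|l] // nk nl; apply: causal => j jn.
  by apply: IH => //; exact: leq_trans jn _.
exists (fun n => a n.+1 n) => n; apply: causal => k kn; exact: stable.
Qed.

Lemma series_inv (A : pzRingType) (f : series A) :
  f 0 = 1 -> exists g : series A, f * g = 1 /\ g * f = 1.
Proof.
have right_inv (h : series A) :
    h 0 = 1 -> exists2 g : series A, g 0 = 1 & h * g = 1.
  (* Comparing coefficients in h g = 1 expresses each coefficient of g by earlier ones. *)
  move=> h0; pose Phi (g : nat -> A) n : A :=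
    if n is m.+1 then - (\sum_(i < m) h i.+1 * g (m - i)%N + h m.+1 * g 0) else 1.
  have [|g gP] := @causal_fixpoint A 0 Phi.
    move=> g g' [|n] //= eq_g; rewrite eq_g //; congr (- (_ + _)).
    by apply: eq_bigr => i _; rewrite eq_g // ltnS leq_subr.
  exists g; first by rewrite gP.
  apply/funext => -[|n]; first by rewrite coef_mul0 h0 gP mulr1.
  by rewrite coef_mulS h0 mul1r [g n.+1]gP -addrA addNr.
(* Since g has the left inverse f and a right inverse h, the two coincide. *)
move=> f0; have [g g0 fg] := right_inv f f0; have [h _ gh] := right_inv g g0.
exists g; split=> //; rewrite -gh; congr (g * _).
by rewrite -[h]mul1r -fg -mulrA gh mulr1.
Qed.

(** * Supports of double series and the factorization G = U V *)

Section Support.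
Variable A : pzRingType.
Implicit Types F G U V : series (series A).

(** In F m n the outer index m is the exponent of s, the inner index n that of t. *)
Definition supported (P : nat -> nat -> bool) F :=
  forall m n, ~~ P m n -> F m n = 0.

Lemma supported_mul (P : nat -> nat -> bool) F G :
  (forall i j k l, P i j -> P k l -> P (i + k)%N (j + l)%N) ->
  supported P F -> supported P G -> supported P (F * G).
Proof.
move=> PD sF sG m n PNmn; rewrite coef_mul coef_sum big1 // => i _.
rewrite coef_mul big1 // => j _.
have [PF|/sF->] := boolP (P i j); last by rewrite mul0r.
have [PG|/sG->] := boolP (P (m - i)%N (n - j)%N); last by rewrite mulr0.
by case/negP: PNmn; have := PD _ _ _ _ PF PG; rewrite !subnKC // -ltnS.
Qed.

Definition below (m n : nat) := (n <= m)%N.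
(** The second clause admits the constant term 1. Away from (0, 0), [above] and [below] are
    complementary. *)
Definition above (m n : nat) := (m < n)%N || (m + n == 0)%N.

Lemma belowD i j k l : below i j -> below k l -> below (i + k) (j + l).
Proof. exact: leq_add. Qed.
Lemma aboveD i j k l : above i j -> above k l -> above (i + k) (j + l).
Proof. rewrite /above; lia. Qed.

(** Row m + 1 of U V is the sum of these rows of U and V plus products of earlier rows. The equation
    thus prescribes only that sum, and the supports say how to split it. *)
Lemma factor_exists G : G 0 = 1 -> exists U V,
  [/\ U 0 = 1, V 0 = 1, supported above U, supported below V & G = U * V].
Proof.
move=> G0.
(* U and V are cut out of a single f, which holds the sum of their rows in positive degree; row 0 of
   both is set to 1. *)
pose U (f : nat -> series A) : series (series A) :=
  fun m n => if m == 0 then (1 : series A) n else if (m < n)%N then f m n else 0.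
pose V (f : nat -> series A) : series (series A) :=
  fun m n => if m == 0 then (1 : series A) n else if (m < n)%N then 0 else f m n.
pose Phi f m : series A :=
  if m is k.+1 then G m - \sum_(i < k) U f i.+1 * V f (k - i)%N else 0.
have [|f fP] := @causal_fixpoint (series A) 0 Phi.
  move=> f g [|m] //= eq_f; congr (_ - _); apply: eq_bigr => i _.
  by congr (_ * _); apply/funext => n; rewrite /U /V /= eq_f // ltnS ?leq_subr.
exists (U f), (V f); split=> //.
- by move=> [|m] n; rewrite /above /U negb_or => /andP[/negbTE->]; case: n.
- move=> [|m] n; rewrite /below /V -ltnNge; first by case: n.
  by move=> ->.
- apply/funext => -[|m]; first by rewrite coef_mul0 G0 mulr1.
  rewrite coef_mulS_unit //.
  have -> : V f m.+1 + U f m.+1 = f m.+1.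
    apply/funext => n; rewrite coef_add /U /V /=.
    by case: ifP; rewrite ?add0r ?addr0.
  by rewrite [f m.+1]fP /= subrK.
Qed.

Lemma factor_unique U V U' V' :
  U 0 = 1 -> V 0 = 1 -> U' 0 = 1 -> V' 0 = 1 ->
  supported above U -> supported below V ->
  supported above U' -> supported below V' -> U * V = U' * V' -> V = V'.
Proof.
move=> U0 V0 U'0 V'0 sU sV sU' sV' eqUV.
suff eqm m : U m = U' m /\ V m = V' m by apply/funext => m; case: (eqm m).
elim/ltn_ind: m => -[|m] IH; first by rewrite U0 V0 U'0 V'0.
have : (U * V) m.+1 = (U' * V') m.+1 by rewrite eqUV.
rewrite (coef_mulS_unit _ U0 V0) (coef_mulS_unit _ U'0 V'0).
have -> : \sum_(i < m) U i.+1 * V (m - i)%N = \sum_(i < m) U' i.+1 * V' (m - i)%N.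
  apply: eq_bigr => i _; have [|-> _] := IH i.+1; first by rewrite ltnS.
  by have [|_ ->] := IH (m - i)%N; first by rewrite ltnS leq_subr.
move/addIr => eqm.
have eqn n : V m.+1 n + U m.+1 n = V' m.+1 n + U' m.+1 n.
  by rewrite -2!coef_add eqm.
(* The supports meet only at (0, 0), so in a positive row each coefficient of the sum belongs to one
   factor. *)
have dich n : ~~ above m.+1 n \/ ~~ below m.+1 n by rewrite /above /below; lia.
split; apply/funext => n; have := eqn n;
  by case: (dich n) => [an|bn]; rewrite ?(sU _ _ an) ?(sU' _ _ an)
    ?(sV _ _ bn) ?(sV' _ _ bn) ?addr0 ?add0r.
Qed.

End Support.

(** * Group-like elements relative to three ring morphisms *)

Section GroupLike.
Variables (A B : pzRingType) (d i1 i2 : {rmorphism A -> B}).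
Hypothesis i12C : forall x y, i1 x * i2 y = i2 y * i1 x.

(** For d the comultiplication, i1 x = x ⊗ 1 and i2 x = 1 ⊗ x this is the usual notion. In this form
    it extends coefficientwise to series and double series, with values in series over H ⊗ H instead
    of a completed tensor product. *)
Definition grouplike x := d x = i1 x * i2 x.

Lemma grouplike_mul x y : grouplike x -> grouplike y -> grouplike (x * y).
Proof.
rewrite /grouplike !rmorphM => -> ->.
by rewrite -!mulrA; congr (_ * _); rewrite !mulrA i12C.
Qed.

(** Both d y and i1 y * i2 y are inverse to d x. *)
Lemma grouplike_inv x y : x * y = 1 -> y * x = 1 -> grouplike x -> grouplike y.
Proof.
move=> xy yx gx.
have e : d x * (i1 y * i2 y) = 1.
  rewrite gx -mulrA (mulrA (i2 x)) -i12C -!mulrA -rmorphM xy rmorph1 mulr1.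
  by rewrite -rmorphM xy rmorph1.
by rewrite /grouplike -[LHS]mulr1 -e mulrA -rmorphM yx rmorph1 mul1r.
Qed.

(** The commutation hypothesis passes to series, and by iteration to double series. *)
Lemma series_map_comm (f g : series A) :
  series_map i1 f * series_map i2 g = series_map i2 g * series_map i1 f.
Proof.
apply/funext => n; rewrite coef_mul [RHS]series_mul_rev.
by apply: eq_bigr => i _; exact: i12C.
Qed.

End GroupLike.

(** * Group-like double series and the lift of a commutator *)

Section GroupLikeSeries.
Variables (A B : pzRingType) (d i1 i2 : {rmorphism A -> B}).
Hypothesis i12C : forall x y, i1 x * i2 y = i2 y * i1 x.

Notation smap f := (series_map f).
Notation gl1 := (grouplike (smap d) (smap i1) (smap i2)).
Notation gl2 := (grouplike (smap (smap d)) (smap (smap i1)) (smap (smap i2))).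

(** Here f is read as a series in t; the next lemma reads it as a series in s. *)
Lemma grouplike_const f : gl1 f -> gl2 (series_const f).
Proof. by rewrite /grouplike /= !series_map_const /= -rmorphM => ->. Qed.

Lemma grouplike_map_const f : gl1 f -> gl2 (smap (@series_const A) f).
Proof.
have nat (phi : {rmorphism A -> B}) :
    smap (smap phi) (smap (@series_const A) f) = smap (@series_const B) (smap phi f).
  by apply/funext => m; exact: series_map_const.
by rewrite /grouplike /= !nat -rmorphM => ->.
Qed.

Lemma coef_map2 (phi : {rmorphism A -> B}) (F : series (series A)) m n :
  smap (smap phi) F m n = phi (F m n).
Proof. by []. Qed.

Lemma supported_map P (phi : {rmorphism A -> B}) F :
  supported P F -> supported P (smap (smap phi) F).
Proof. by move=> sF m n /sF Fmn; rewrite coef_map2 Fmn rmorph0. Qed.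

Lemma grouplike_below (U V : series (series A)) : U 0 = 1 -> V 0 = 1 ->
  supported above U -> supported below V -> gl2 (U * V) -> gl2 V.
Proof.
move=> U0 V0 sU sV; rewrite /grouplike !rmorphM => gUV.
have map0 (phi : {rmorphism A -> B}) (F : series (series A)) :
    F 0 = 1 -> smap (smap phi) F 0 = 1.
  by move=> F0; rewrite coef_map F0 rmorph1.
apply: (@factor_unique _ (smap (smap d) U) (smap (smap d) V)
  (smap (smap i1) U * smap (smap i2) U)
  (smap (smap i1) V * smap (smap i2) V)); rewrite ?coef_mul0 ?map0 ?mulr1 //.
- exact: supported_map.
- exact: supported_map.
- by apply: supported_mul; [exact: aboveD|exact: supported_map..].
- by apply: supported_mul; [exact: belowD|exact: supported_map..].
(* It remains to move the image of U under i2 past that of V under i1. *)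
- rewrite gUV -!mulrA; congr (_ * _); rewrite !mulrA; congr (_ * _).
  exact: series_map_comm (series_map_comm i12C) _ _.
Qed.

(* The only way to write (n, n) as a sum of two points (i, j) with j <= i is to
   use two points of the diagonal. *)
Lemma grouplike_diagonal (V : series (series A)) : supported below V -> gl2 V -> gl1 (fun n => V n n).
Proof.
move=> sV gV; apply/funext => n.
rewrite -[LHS]/(smap (smap d) V n n) gV coef_mul coef_sum.
apply: eq_bigr => i _; rewrite coef_mul (bigD1 i) //= big1 ?addr0 // => j ji.
have [lt_ij|] := ltnP i j.
  by rewrite coef_map (sV i j) ?rmorph0 ?mul0r // /below -ltnNge.
move=> le_ji; rewrite [X in _ * X]coef_map (sV (n - i)%N) ?rmorph0 ?mulr0 //.
have := ltn_ord i; move: ji; rewrite -val_eqE /below /=; lia.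
Qed.

Lemma grouplike_lift_commutator (a b : series A) :
  a 0 = 1 -> b 0 = 1 -> gl1 a -> gl1 b ->
  exists c : series A, [/\ c 0 = 1, gl1 c & c 1 = a 1 * b 1 - b 1 * a 1].
Proof.
move=> a0 b0 ga gb; have [b' [bb' b'b]] := series_inv b0.
have i12C2 := series_map_comm (series_map_comm i12C).
pose G := series_const b' * smap (@series_const A) a * series_const b.
have gG : gl2 G.
  apply: grouplike_mul => //; last exact: grouplike_const.
  apply: grouplike_mul => //; last exact: grouplike_map_const.
  by apply: grouplike_const; apply: grouplike_inv bb' b'b gb; exact: series_map_comm.
(* Row 0 of G is the conjugate of a_0 = 1. *)
have G0 : G 0 = 1.
  by rewrite /G 2!coef_mul0 /= a0 rmorph1 mulr1.
have [U [V [U0 V0 sU sV GE]]] := factor_exists G0.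
have gV : gl2 V by apply: grouplike_below U0 V0 sU sV _; rewrite -GE.
exists (fun n => V n n); split; first by rewrite V0.
  exact: grouplike_diagonal.
have b'0 : b' 0 = 1.
  by have := congr1 (fun f : series A => f 0) bb'; rewrite coef_mul0 b0 mul1r.
have b'1 : b' 1 = - b 1.
  have := congr1 (fun f : series A => f 1) bb'.
  by rewrite coef_mul1 b0 b'0 mul1r mulr1 => /eqP; rewrite addr_eq0 => /eqP.
(* Row 1 of U V is U 1 + V 1, and (1, 1) lies outside the support of U. *)
have G11 : G 1 1 = V 1 1.
  by rewrite GE coef_mul1 U0 V0 mul1r mulr1 coef_add (sU 1 1) ?addr0.
(* Row 1 of G is b(t)^-1 a_1 b(t), where b(t)^-1 begins with 1 - b_1 t. *)
rewrite -G11 /G coef_mul1 coef_mul0 coef_mul1 /= mulr0 add0r mul0r addr0.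
rewrite coef_mul1 coef_mul0 coef_mul1 /=.
by rewrite b'0 b'1 b0 mul1r mulr1 mulr0 add0r mulNr.
Qed.

End GroupLikeSeries.

(** * Liftable elements of a bialgebra *)

Section Liftable.
Variables (R : comPzRingType) (H : bialgType R).

Definition tens1r (x : H) : tensor H H := x ⊗ 1.
Definition tens1l (x : H) : tensor H H := 1 ⊗ x.

Lemma tens1r_is_zmod : zmod_morphism tens1r.
Proof.
move=> x y; rewrite /tens1r (bilinDl (tens_bilin _ _)) -scaleN1r.
by rewrite (bilinZl (tens_bilin _ _)) scaleN1r.
Qed.
Lemma tens1r_is_monoid : monoid_morphism tens1r.
Proof. by split=> // x y; rewrite /tens1r mul_tens mulr1. Qed.
Lemma tens1l_is_zmod : zmod_morphism tens1l.
Proof.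
move=> x y; rewrite /tens1l (bilinDr (tens_bilin _ _)) -scaleN1r.
by rewrite (bilinZr (tens_bilin _ _)) scaleN1r.
Qed.
Lemma tens1l_is_monoid : monoid_morphism tens1l.
Proof. by split=> // x y; rewrite /tens1l mul_tens mulr1. Qed.

HB.instance Definition _ :=
  GRing.isZmodMorphism.Build H (tensor H H) tens1r tens1r_is_zmod.
HB.instance Definition _ :=
  GRing.isMonoidMorphism.Build H (tensor H H) tens1r tens1r_is_monoid.
HB.instance Definition _ :=
  GRing.isZmodMorphism.Build H (tensor H H) tens1l tens1l_is_zmod.
HB.instance Definition _ :=
  GRing.isMonoidMorphism.Build H (tensor H H) tens1l tens1l_is_monoid.

Lemma tens1_comm (x y : H) : tens1r x * tens1l y = tens1l y * tens1r x.
Proof. by rewrite !mul_tens !mul1r !mulr1. Qed.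

Notation gl := (grouplike (series_map (@comul R H)) (series_map tens1r)
  (series_map tens1l)).

(** As (x ⊗ 1)(1 ⊗ y) = x ⊗ y, the Cauchy product of the two images of a has exactly the sums
    required of Δ(a_n) as coefficients. *)
Lemma grouplike_seriesP (a : series H) :
  grouplike_series a <-> a 0 = 1 /\ gl a.
Proof.
have sumE n : (series_map tens1r a * series_map tens1l a) n =
    \sum_(m < n.+1) a m ⊗ a (n - m)%N.
  by rewrite coef_mul; apply: eq_bigr => m _; rewrite mul_tens mul1r mulr1.
split=> -[a0 ga]; split=> //; first by apply/funext => n; rewrite sumE -ga.
by move=> n; rewrite -sumE -[in RHS]ga.
Qed.

Lemma liftable0 : liftable (0 : H).
Proof.
exists (1 : series H) => //; apply/grouplike_seriesP; split=> //.
by rewrite /grouplike !rmorph1 mulr1.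
Qed.

Lemma liftableD (x y : H) : liftable x -> liftable y -> liftable (x + y).
Proof.
move=> [a /grouplike_seriesP[a0 ga] <-] [b /grouplike_seriesP[b0 gb] <-].
exists ((a : series H) * (b : series H)).
  apply/grouplike_seriesP; split; first by rewrite coef_mul0 a0 b0 mulr1.
  by apply: grouplike_mul => //; exact: series_map_comm tens1_comm.
by rewrite coef_mul1 a0 b0 mul1r mulr1 addrC.
Qed.

Lemma liftableZ (r : R) (x : H) : liftable x -> liftable (r *: x).
Proof.
move=> [a [a0 ga] <-]; exists (fun n => r ^+ n *: a n); last by rewrite expr1.
split=> [|n]; first by rewrite expr0 scale1r.
rewrite linearZ /= ga scaler_sumr; apply: eq_bigr => m _.
rewrite (bilinZl (tens_bilin _ _)) (bilinZr (tens_bilin _ _)) scalerA -exprD.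
by rewrite subnKC // -ltnS.
Qed.

Lemma liftable_lie (x y : H) : liftable x -> liftable y -> liftable (lie x y).
Proof.
move=> [a /grouplike_seriesP[a0 ga] <-] [b /grouplike_seriesP[b0 gb] <-].
have [c [c0 gc c1]] := grouplike_lift_commutator tens1_comm a0 b0 ga gb.
by exists c => //; apply/grouplike_seriesP.
Qed.

End Liftable.

Theorem theorem2p14 (R : comPzRingType) (H : bialgType R)
    (H_cocomm : cocommutative H) :
  lie_subalgebra (fun x : H => liftable x).
Proof.
split; [exact: liftable0|exact: liftableD|exact: liftableZ|exact: liftable_lie].
Qed.
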